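(* Suppose that the constrained convex problem (P) has a KKT point and that the Lipschitz/boundedness assumption (both described in the context) holds. Let $\{w^k\}=\{(x^k,y^k,z^k)\}$ be the sequence generated by the linearized augmented Lagrangian method (LALM, described in the context) started from any $x^0$, any $y^0$, and any $z^0$ with $z_j^0\ge 0$ for all $j=1,\dots,m$. If $\rho_y,\rho_z\in(0,\beta)$ and $\delta>0$, then $w^k$ converges to a KKT point $\bar w=(\bar x,\bar y,\bar z)$ of (P).
   Context: Problem (P): $\min_{x\in\mathbb R^p} f_0(x):=g(x)+h(x)$ subject to $Ax=b$, $f_j(x)\le 0$ for $j=1,\dots,m$, where $A\in\mathbb R^{q\times p}$, $b\in\mathbb R^q$, $g,f_1,\dots,f_m:\mathbb R^p\to\mathbb R$ are convex and differentiable with Lipschitz gradients, and $h:\mathbb R^p\to(-\infty,+\infty]$ is proper, closed and convex (possibly nondifferentiable). $\|\cdot\|$ is the Euclidean norm (spectral norm for matrices); $[a]_+=\max(0,a)$. KKT point: $w=(x,y,z)\in\mathbb R^p\times\mathbb R^q\times\mathbb R^m$ is a KKT point of (P) if $0\in\nabla g(x)+\partial h(x)+A^\top y+\sum_{j=1}^m z_j\nabla f_j(x)$, $Ax=b$, and $z_j\ge0$, $f_j(x)\le0$, $z_jf_j(x)=0$ for all $j$. Lipschitz/boundedness assumption: there are constants $L_g,L_1,\dots,L_m$ and $B_1,\dots,B_m$ such that for all $\hat x,\tilde x\in\mathrm{dom}(h)$ and all $j$: $\|\nabla g(\hat x)-\nabla g(\tilde x)\|\le L_g\|\hat x-\tilde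 x\|$, $\|\nabla f_j(\hat x)-\nabla f_j(\tilde x)\|\le L_j\|\hat x-\tilde x\|$, and $\|\nabla f_j(\hat x)\|\le B_j$. Augmented Lagrangian: for a penalty parameter $\beta>0$, let $\psi_\beta(u,v)=uv+\frac\beta2u^2$ if $\beta u+v\ge0$ and $\psi_\beta(u,v)=-\frac{v^2}{2\beta}$ if $\beta u+v<0$; $\Psi_\beta(x,z)=\sum_{j=1}^m\psi_\beta(f_j(x),z_j)$; and $F_\beta(x,y,z)=g(x)+y^\top(Ax-b)+\frac\beta2\|Ax-b\|^2+\Psi_\beta(x,z)$. LALM: given parameters $\beta,\rho_y,\rho_z>0$, $\delta\ge0$ and an initial point $w^0=(x^0,y^0,z^0)$, set $\eta^{-1}=0$. For $k=0,1,\dots$, let $L_F^k=L_g+\beta\|A\|^2+\sum_{j=1}^m\big(\beta B_j^2+L_j[\beta f_j(x^k)+z_j^k]_+\big)$, $\eta^k=\max(\eta^{k-1},L_F^k+\delta)$, and $$x^{k+1}=\arg\min_x\; h(x)+\langle\nabla_xF_\beta(w^k),x\rangle+\frac{\eta^k}2\|x-x^k\|^2,$$ $$y^{k+1}=y^k+\rho_y(Ax^{k+1}-b),\qquad z_j^{k+1}=z_j^k+\rho_z\max\Big(-\frac{z_j^k}\beta,f_j(x^{k+1})\Big),\ j=1,\dots,m.$$ *)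

(* Defs.v *)
From HB Require Import structures.
From mathcomp Require Import all_boot all_order all_algebra.
From mathcomp Require Import all_classical all_reals all_analysis.

Set Implicit Arguments.
Unset Strict Implicit.
Unset Printing Implicit Defensive.

Import Order.TTheory GRing.Theory Num.Theory.
Import numFieldNormedType.Exports.

Local Open Scope classical_set_scope.
Local Open Scope ring_scope.

(* The library norm [`|_|] on matrices is the sup norm, so the Euclidean and
   spectral norms are introduced here.  The library topology on ['cV[R]_n] is
   the usual one. *)

Definition dotv (R : realType) (n : nat) (u v : 'cV[R]_n) : R :=
  \sum_(i < n) u i 0 * v i 0.

Definition enorm (R : realType) (n : nat) (u : 'cV[R]_n) : R :=
  Num.sqrt (dotv u u).

Definition spectral_norm (R : realType) (q p : nat) (A : 'M[R]_(q, p)) : R :=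
  sup [set enorm (A *m v) | v in [set v : 'cV[R]_p | enorm v <= 1]].

Definition grad (R : realType) (n : nat) (f : 'cV[R]_n -> R) (x : 'cV[R]_n) :
    'cV[R]_n :=
  \col_(i < n) 'D_(delta_mx i 0) f x.

Definition lipschitz_grad (R : realType) (n : nat) (L : R)
    (D : set 'cV[R]_n) (f : 'cV[R]_n -> R) : Prop :=
  forall x x', D x -> D x' ->
    enorm (grad f x - grad f x') <= L * enorm (x - x').

Definition edom (R : realType) (n : nat) (h : 'cV[R]_n -> \bar R) :
    set 'cV[R]_n :=
  [set x | (h x < +oo)%E].

Definition eproper (R : realType) (n : nat) (h : 'cV[R]_n -> \bar R) : Prop :=
  (forall x, (-oo < h x)%E) /\ edom h !=set0.

Definition eclosed (R : realType) (n : nat) (h : 'cV[R]_n -> \bar R) : Prop :=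
  closed [set xt : 'cV[R]_n * R | (h xt.1 <= xt.2%:E)%E].

(* Used only for functions that never take the value -oo, so the right-hand
   side is never of the form +oo - oo; the convention 0 * +oo = 0 makes the
   cases t = 0 and t = 1 trivial. *)
Definition econvex (R : realType) (n : nat) (h : 'cV[R]_n -> \bar R) : Prop :=
  forall (x x' : 'cV[R]_n) (t : R), 0 <= t <= 1 ->
    (h (t *: x + (1 - t) *: x')%R <= t%:E * h x + (1 - t)%:E * h x')%E.

Definition subdifferential (R : realType) (n : nat) (h : 'cV[R]_n -> \bar R)
    (x : 'cV[R]_n) : set 'cV[R]_n :=
  [set s | forall x', (h x + (dotv s (x' - x)%R)%:E <= h x')%E].

(* min g(x) + h(x)  subject to  A x = b,  f_j(x) <= 0, with data listed in the
   order g, h, A, b, f. *)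
Record problem (R : realType) (p q m : nat) := Problem {
  smooth_obj : 'cV[R]_p -> R ;
  nonsmooth_obj : 'cV[R]_p -> \bar R ;
  eq_mx : 'M[R]_(q, p) ;
  eq_rhs : 'cV[R]_q ;
  ineq : 'I_m -> 'cV[R]_p -> R }.

Definition smooth_convex (R : realType) (n : nat) (f : 'cV[R]_n -> R) : Prop :=
  [/\ convex_function [set: 'cV[R]_n] f,
      forall x, differentiable f x &
      exists L, lipschitz_grad L [set: 'cV[R]_n] f].

Definition convex_problem (R : realType) (p q m : nat) (P : problem R p q m) :
    Prop :=
  [/\ smooth_convex (smooth_obj P),
      forall j, smooth_convex (ineq P j),
      eproper (nonsmooth_obj P),
      eclosed (nonsmooth_obj P) &
      econvex (nonsmooth_obj P)].

Definition is_KKT (R : realType) (p q m : nat) (P : problem R p q m)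
    (x : 'cV[R]_p) (y : 'cV[R]_q) (z : 'cV[R]_m) : Prop :=
  [/\ exists2 s, subdifferential (nonsmooth_obj P) x s &
        0 = grad (smooth_obj P) x + s + (eq_mx P)^T *m y
            + \sum_(j < m) z j 0 *: grad (ineq P j) x,
      eq_mx P *m x = eq_rhs P &
      forall j, [/\ 0 <= z j 0, ineq P j x <= 0 & z j 0 * ineq P j x = 0]].

Definition lipschitz_bounded (R : realType) (p q m : nat)
    (P : problem R p q m) (Lg : R) (L B : 'I_m -> R) : Prop :=
  let D := edom (nonsmooth_obj P) in
  lipschitz_grad Lg D (smooth_obj P) /\
  forall j, lipschitz_grad (L j) D (ineq P j) /\
    forall x, D x -> enorm (grad (ineq P j) x) <= B j.

Definition psi (R : realType) (beta u v : R) : R :=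
  if 0 <= beta * u + v then u * v + beta / 2 * u ^+ 2
  else - (v ^+ 2 / (2 * beta)).

Definition Psi (R : realType) (p q m : nat) (P : problem R p q m) (beta : R)
    (x : 'cV[R]_p) (z : 'cV[R]_m) : R :=
  \sum_(j < m) psi beta (ineq P j x) (z j 0).

Definition auglag (R : realType) (p q m : nat) (P : problem R p q m) (beta : R)
    (x : 'cV[R]_p) (y : 'cV[R]_q) (z : 'cV[R]_m) : R :=
  let r := eq_mx P *m x - eq_rhs P in
  smooth_obj P x + dotv y r + beta / 2 * enorm r ^+ 2 + Psi P beta x z.

Definition LF (R : realType) (p q m : nat) (P : problem R p q m) (Lg : R)
    (L B : 'I_m -> R) (beta : R) (x : 'cV[R]_p) (z : 'cV[R]_m) : R :=
  Lg + beta * spectral_norm (eq_mx P) ^+ 2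
  + \sum_(j < m) (beta * B j ^+ 2
                  + L j * Num.max 0 (beta * ineq P j x + z j 0)).

(* The base case encodes the convention eta^{-1} = 0. *)
Fixpoint eta (R : realType) (p q m : nat) (P : problem R p q m) (Lg : R)
    (L B : 'I_m -> R) (beta delta : R) (x : nat -> 'cV[R]_p)
    (z : nat -> 'cV[R]_m) (k : nat) : R :=
  Num.max (if k is k'.+1 then eta P Lg L B beta delta x z k' else 0)
          (LF P Lg L B beta (x k) (z k) + delta).

Definition argmin (R : realType) (T : Type) (phi : T -> \bar R) : set T :=
  [set x | forall x', (phi x <= phi x')%E].

Definition is_LALM (R : realType) (p q m : nat) (P : problem R p q m) (Lg : R)
    (L B : 'I_m -> R) (beta rho_y rho_z delta : R) (x : nat -> 'cV[R]_p)
    (y : nat -> 'cV[R]_q) (z : nat -> 'cV[R]_m) : Prop :=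
  forall k,
  [/\ argmin (fun u => nonsmooth_obj P u
        + (dotv (grad (fun v => auglag P beta v (y k) (z k)) (x k)) u
           + eta P Lg L B beta delta x z k / 2 * enorm (u - x k) ^+ 2)%R%:E)%E
        (x k.+1),
      y k.+1 = y k + rho_y *: (eq_mx P *m x k.+1 - eq_rhs P) &
      forall j, z k.+1 j 0 =
        z k j 0 + rho_z * Num.max (- (z k j 0 / beta)) (ineq P j (x k.+1))].

(* Main.v *)
Require Import Defs.
From mathcomp Require Import all_boot all_order all_algebra.
From mathcomp Require Import all_classical all_reals all_analysis.
From mathcomp Require Import ring lra.

(* Let (xs, ys, zs) be a KKT point.  Optimality of the proximal step, convexity,
   the descent lemma on dom h and the multiplier updates yield, with
   X_k = |x^k - xs|^2 and Y_k = |y^k - ys|^2 / rho_y + |z^k - zs|^2 / rho_z,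
     eta^k (X_{k+1} - X_k) + (Y_{k+1} - Y_k) + delta |x^{k+1} - x^k|^2
       + (beta - rho_y) |A x^{k+1} - b|^2 + (beta - rho_z) |s^k|^2 <= 0,
   where z^{k+1} = z^k + rho_z s^k.  This holds only from k = 1 on, because x^0
   may lie outside dom h.  As eta^k is nondecreasing, X_k + Y_k / eta^k is
   nonincreasing, so Y_k = O(eta^k); since eta^k grows at most linearly in
   |z^k|, hence like the square root of Y_k, it is bounded.  Therefore the
   iterates are bounded and the three squared increments vanish.  The limit
   along an ultrafilter is a KKT point by closedness of h, and the monotone
   quantity taken at that KKT point tends to 0 along the ultrafilter, hence
   along the whole sequence. *)

Set Implicit Arguments.
Unset Strict Implicit.
Unset Printing Implicit Defensive.

Import Order.TTheory GRing.Theory Num.Theory.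
Import numFieldNormedType.Exports.

Local Open Scope classical_set_scope.
Local Open Scope ring_scope.

(** * Euclidean inner product and norm *)

Section dotv_theory.
Variables (R : realType) (n : nat).
Implicit Types (u v w : 'cV[R]_n) (a : R).

Lemma dotvC u v : dotv u v = dotv v u.
Proof. by apply: eq_bigr => i _; rewrite mulrC. Qed.

Lemma dotvDl u v w : dotv (u + v) w = dotv u w + dotv v w.
Proof. by rewrite -big_split; apply: eq_bigr => i _; rewrite mxE mulrDl. Qed.

Lemma dotvZl a u w : dotv (a *: u) w = a * dotv u w.
Proof. by rewrite mulr_sumr; apply: eq_bigr => i _; rewrite mxE mulrA. Qed.

Lemma dotvNl u w : dotv (- u) w = - dotv u w.
Proof. by rewrite -scaleN1r dotvZl mulN1r. Qed.

Lemma dotv0l w : dotv 0 w = 0.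
Proof. by rewrite -(scale0r 0) dotvZl mul0r. Qed.

Lemma dotvDr w u v : dotv w (u + v) = dotv w u + dotv w v.
Proof. by rewrite dotvC dotvDl !(dotvC _ w). Qed.

Lemma dotvZr a w u : dotv w (a *: u) = a * dotv w u.
Proof. by rewrite dotvC dotvZl dotvC. Qed.

Lemma dotvNr w u : dotv w (- u) = - dotv w u.
Proof. by rewrite dotvC dotvNl dotvC. Qed.

Lemma dotv0r w : dotv w 0 = 0.
Proof. by rewrite dotvC dotv0l. Qed.

Definition dotvE := (dotvDl, dotvDr, dotvNl, dotvNr, dotvZl, dotvZr).

Lemma dotv_sqrD a u v : dotv (a *: u + v) (a *: u + v) =
  a ^+ 2 * dotv u u + 2 * a * dotv v u + dotv v v.
Proof. by rewrite !dotvE (dotvC u v); ring. Qed.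

Lemma dotv_suml (I : finType) (F : I -> 'cV[R]_n) w :
  dotv (\sum_i F i) w = \sum_i dotv (F i) w.
Proof.
apply: (big_morph (fun u => dotv u w)) => [u v|]; first exact: dotvDl.
exact: dotv0l.
Qed.

Lemma dotv_ge0 u : 0 <= dotv u u.
Proof. by apply: sumr_ge0 => i _; rewrite -expr2 sqr_ge0. Qed.

Lemma dotv_coord u i : u i 0 ^+ 2 <= dotv u u.
Proof.
rewrite /dotv (bigD1 i) //= expr2 lerDl.
by apply: sumr_ge0 => j _; rewrite -expr2 sqr_ge0.
Qed.

Lemma enorm_ge0 u : 0 <= enorm u.
Proof. exact: sqrtr_ge0. Qed.

Lemma enorm_sqr u : enorm u ^+ 2 = dotv u u.
Proof. exact/sqr_sqrtr/dotv_ge0. Qed.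

Lemma enorm_eq0 u : enorm u = 0 -> u = 0.
Proof.
move=> u0; apply/matrixP => i j; rewrite ord1 mxE.
apply/eqP; rewrite -sqrf_eq0 eq_le sqr_ge0 andbT.
by rewrite (le_trans (dotv_coord _ _)) // -enorm_sqr u0 expr0n.
Qed.

Lemma enormZ a u : enorm (a *: u) = `|a| * enorm u.
Proof.
by rewrite /enorm !dotvE mulrA -expr2 sqrtrM ?sqr_ge0// sqrtr_sqr.
Qed.

Lemma enormN u : enorm (- u) = enorm u.
Proof. by rewrite /enorm !dotvE opprK. Qed.

(** The squared norm of [dotv v v *: u - dotv u v *: v] is [dotv v v] times the Gram determinant of
    [u] and [v], which is therefore nonnegative when [v] is nonzero. *)
Lemma dotv_cauchy_schwarz u v : `|dotv u v| <= enorm u * enorm v.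
Proof.
have [v0|v0] := eqVneq (enorm v) 0.
  by rewrite (enorm_eq0 v0) dotv0r normr0 mulr_ge0 ?enorm_ge0.
have vgt0 : 0 < dotv v v.
  by rewrite -enorm_sqr lt_neqAle eq_sym sqrf_eq0 v0 sqr_ge0.
rewrite -ler_sqr ?nnegrE ?mulr_ge0 ?enorm_ge0// exprMn.
rewrite !enorm_sqr real_normK ?num_real//.
have := dotv_ge0 (dotv v v *: u - dotv u v *: v).
rewrite !dotvE (dotvC v u) => H.
have : 0 <= dotv v v * (dotv u u * dotv v v - dotv u v ^+ 2) by nra.
by rewrite pmulr_rge0// subr_ge0.
Qed.

Lemma dotv_le_enorm u v : dotv u v <= enorm u * enorm v.
Proof. exact: le_trans (ler_norm _) (dotv_cauchy_schwarz u v). Qed.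

End dotv_theory.

(** * Matrices as linear maps and the spectral norm *)

Lemma dotv_adjoint (R : realType) (p q : nat) (A : 'M[R]_(q, p)) y u :
  dotv (A^T *m y) u = dotv y (A *m u).
Proof.
rewrite /dotv; under eq_bigr do rewrite mxE mulr_suml.
rewrite exchange_big; apply: eq_bigr => i _; rewrite mxE mulr_sumr.
by apply: eq_bigr => j _; rewrite !mxE mulrCA mulrA.
Qed.

(** Cauchy-Schwarz on each row gives the Frobenius bound. It shows that the set defining
    [spectral_norm] is bounded above, so that its [sup] is a true supremum. *)
Lemma mulmx_enorm_bounded (R : realType) (p q : nat) (A : 'M[R]_(q, p)) v :
  enorm (A *m v) <= Num.sqrt (\sum_i enorm (row i A)^T ^+ 2) * enorm v.
Proof.
have H0 : 0 <= \sum_i enorm (row i A)^T ^+ 2.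
  by apply: sumr_ge0 => i _; apply: sqr_ge0.
rewrite -ler_sqr ?nnegrE ?mulr_ge0 ?enorm_ge0 ?sqrtr_ge0//.
rewrite enorm_sqr exprMn [Num.sqrt _ ^+ 2]sqr_sqrtr// mulr_suml.
apply: ler_sum => i _; rewrite -expr2 -exprMn -[leLHS]real_normK ?num_real//.
rewrite ler_sqr ?nnegrE ?mulr_ge0 ?enorm_ge0//.
apply: le_trans (dotv_cauchy_schwarz _ _).
by rewrite le_eqVlt; apply/orP; left; apply/eqP; congr `|_|; rewrite mxE;
  apply: eq_bigr => j _; rewrite !mxE.
Qed.

Lemma mulmx_le_spectral (R : realType) (p q : nat) (A : 'M[R]_(q, p)) v :
  enorm (A *m v) <= spectral_norm A * enorm v.
Proof.
have [v0|v0] := eqVneq (enorm v) 0.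
  rewrite (enorm_eq0 v0) mulmx0 /enorm !dotv0l sqrtr0 mulr0 //.
have vgt0 : 0 < enorm v by rewrite lt_neqAle eq_sym v0 enorm_ge0.
rewrite -ler_pdivrMr// -[X in X <= _](_ : enorm (A *m ((enorm v)^-1 *: v)) = _).
  apply: ub_le_sup; last first.
    exists ((enorm v)^-1 *: v) => //=.
    by rewrite enormZ gtr0_norm ?invr_gt0// mulVf.
  exists (Num.sqrt (\sum_i enorm (row i A)^T ^+ 2)) => _ [u /= u1 <-].
  apply: le_trans (mulmx_enorm_bounded _ _) _.
  by rewrite ler_piMr// sqrtr_ge0.
by rewrite -scalemxAr enormZ gtr0_norm ?invr_gt0// mulrC.
Qed.

(** * A scalar inequality for the multiplier update *)

(** Since [v s + beta / 2 s^2 = psi beta fn v], three facts lie behind this: [psi] has a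
    [beta]-Lipschitz derivative in its first argument; convexity and [psi beta 0 v = 0] bound
    [psi beta f v] by [f] times that derivative; and [zs (s - fn) >= 0]. The proof checks the result
    directly, by the signs of [fn + w] and [f + w]. *)
Lemma multiplier_descent (R : realType) (beta f v zs fn : R) :
  0 < beta -> 0 <= v -> 0 <= zs ->
  let s := Num.max (- (v / beta)) fn in
  (v - zs) * s + beta / 2 * s ^+ 2 + zs * fn - beta / 2 * (fn - f) ^+ 2
  <= Num.max 0 (beta * f + v) * fn.
Proof.
move=> b0 v0 zs0 /=.
set w := v / beta; have -> : v = beta * w by rewrite /w mulrC divfK// gt_eqF.
have w0 : 0 <= w by rewrite /w divr_ge0// ltW.
rewrite -mulrDr.
have -> : Num.max 0 (beta * (f + w)) = beta * Num.max 0 (f + w).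
  by rewrite maxr_pMr ?ltW// mulr0.
have sq t : 0 <= beta * t ^+ 2 by rewrite mulr_ge0 ?sqr_ge0// ltW.
have zs_slack : fn < - w -> 0 <= zs * (- w - fn).
  by move=> h; rewrite mulr_ge0// subr_ge0 ltW.
have [hf|hf] := leP (- w) fn; have [hf'|hf'] := leP 0 (f + w).
- have := sq f; nra.
- have : 0 <= beta * (((fn - f) - (fn + w)) * ((fn - f) + (fn + w))).
    by rewrite mulr_ge0 ?(ltW b0)// mulr_ge0//; lra.
  by nra.
- have := zs_slack hf; have := sq f; have := sq (fn + w); nra.
- have := zs_slack hf; have := sq (fn - f); have := sq w; nra.
Qed.

(** * Gradients, convexity and the descent lemma *)

Lemma is_derive_grad (R : realType) (n : nat) (f : 'cV[R]_n -> R) x v :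
  differentiable f x -> is_derive x v f (dotv (grad f x) v).
Proof.
move=> df; apply: DeriveDef; first exact: diff_derivable.
rewrite deriveE// [in LHS](matrix_sum_delta v) linear_sum.
apply: eq_bigr => i _; rewrite big_ord1 linearZ /= mxE deriveE//.
by rewrite mulrC.
Qed.

Lemma is_derive_cvg (R : realType) (n : nat) (f : 'cV[R]_n -> R) x v (D : R) :
  is_derive x v f D <->
  h^-1 * (f (h *: v + x) - f x) @[h --> 0^'] --> D.
Proof.
split=> [[dfx <-]|H]; first exact: dfx.
by apply: DeriveDef; [apply/cvg_ex; exists D|apply/cvg_lim].
Qed.

(** Directional derivatives suffice to identify [grad], so the gradient of the augmented Lagrangian
    is computed without its Frechet differential. *)
Lemma gradP (R : realType) (n : nat) (f : 'cV[R]_n -> R) x u :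
  (forall v, is_derive x v f (dotv u v)) -> grad f x = u.
Proof.
move=> H; apply/matrixP => i j; rewrite ord1 mxE derive_val /dotv.
rewrite (bigD1 i)//= big1 ?addr0 ?mxE ?eqxx ?mulr1// => k ki.
by rewrite !mxE (negbTE ki) mulr0.
Qed.

Lemma convex_combination (R : realType) (n : nat) (f : 'cV[R]_n -> R)
    (x y : 'cV[R]_n) (t : R) :
  convex_function [set: 'cV[R]_n] f -> 0 <= t <= 1 ->
  f (t *: (y - x) + x) <= f x + t * (f y - f x).
Proof.
move=> cf /andP[t0 t1].
have H : f (t *: y + (1 - t) *: x) <= t * f y + (1 - t) * f x.
  by apply: (cf (Itv01 t0 t1) y x); rewrite inE.
rewrite scalerBr addrAC -addrA -[x in _ + (x - _)]scale1r -scalerBl.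
by apply: le_trans H _; rewrite le_eqVlt; apply/orP; left; apply/eqP; ring.
Qed.

(** For [0 < t <= 1] convexity bounds the difference quotient along [y - x] by [f y - f x]; let [t]
    tend to 0 from the right. *)
Lemma convex_grad_le (R : realType) (n : nat) (f : 'cV[R]_n -> R)
    (x y : 'cV[R]_n) :
  convex_function [set: 'cV[R]_n] f -> differentiable f x ->
  dotv (grad f x) (y - x) <= f y - f x.
Proof.
move=> cf df.
have /is_derive_cvg/cvg_dnbhs_at_right H := is_derive_grad (y - x) df.
apply: cvgr_to_le H _; near=> t.
have t0 : 0 < t by near: t; exact: nbhs_right_gt.
have t1 : t <= 1 by near: t; exact: nbhs_right_le.
rewrite ler_pdivrMl// lerBlDl; apply: convex_combination => //.
by rewrite ltW.
Unshelve. all: by end_near. Qed.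

(** The mean value theorem on [0, 1] is applied to [phi], from which the quadratic term is already
    subtracted: its derivative is nonpositive, and the constant [L / 2] comes out without
    integration. The gradient is compared only at points of the segment, hence in [D]. *)
Lemma descent_lemma (R : realType) (n : nat) (f : 'cV[R]_n -> R) L
    (D : set 'cV[R]_n) (x y : 'cV[R]_n) :
  (forall x, differentiable f x) -> lipschitz_grad L D f ->
  (forall t, 0 <= t <= 1 -> D (t *: (y - x) + x)) ->
  f y <= f x + dotv (grad f x) (y - x) + L / 2 * dotv (y - x) (y - x).
Proof.
move=> df Lf Dseg; set d := y - x.
pose N := dotv d d; pose G := dotv (grad f x) d.
pose phi t := f (t *: d + x) - t * G - L / 2 * N * t ^+ 2.
have dphi (t : R) :
    is_derive t 1 phi (dotv (grad f (t *: d + x)) d - G - L * N * t).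
  have Hf : is_derive t 1 (fun t => f (t *: d + x))
                          (dotv (grad f (t *: d + x)) d).
    have /is_derive_cvg H := is_derive_grad d (df (t *: d + x)).
    apply: DeriveDef; rewrite /derivable /derive.
      apply/cvg_ex; exists (dotv (grad f (t *: d + x)) d).
      by under eq_fun do rewrite /= [_ *: 1]mulr1 scalerDl -addrA.
    apply/cvg_lim => //.
    by under eq_fun do rewrite /= [_ *: 1]mulr1 scalerDl -addrA.
  rewrite /phi; apply: is_derive_eq.
  set gd := dotv (grad f (t *: d + x)) d.
  rewrite /GRing.scale /= !mulr1 mulr0 add0r; congr (_ - _ - _).
  by rewrite -mulr2n; field.
have [|c] := @MVT_segment R phi _ 0 1 ler01 (fun t _ => dphi t).
  by apply: derivable_within_continuous => t _; exact: ex_derive.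
rewrite in_itv /= => c01.
rewrite /phi !scale0r add0r scale1r subrK subr0 mulr1 => E.
have c0 : 0 <= c by case/andP: c01.
have xD : D x by have := Dseg 0; rewrite scale0r add0r lexx ler01; apply.
have : dotv (grad f (c *: d + x)) d - G <= L * N * c.
  rewrite /G -dotvNl -dotvDl; apply: le_trans (dotv_le_enorm _ _) _.
  apply: le_trans (ler_wpM2r (enorm_ge0 _) (Lf _ _ (Dseg _ c01) xD)) _.
  rewrite addrK enormZ ger0_norm// /N -enorm_sqr.
  by rewrite le_eqVlt; apply/orP; left; apply/eqP; ring.
by rewrite -/G -/N; nra.
Qed.

(** * Gradient of the augmented Lagrangian *)

(** With [w = v / beta], [psi] is [beta / 2] times a squared positive part minus a constant. The
    quadratic remainder bound gives the derivative uniformly, including at the kink. *)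
Lemma psi_taylor (R : realType) (beta v a c : R) : 0 < beta ->
  `|psi beta c v - psi beta a v - Num.max 0 (beta * a + v) * (c - a)|
    <= beta / 2 * (c - a) ^+ 2.
Proof.
move=> b0; set w := v / beta.
have -> : v = beta * w by rewrite /w mulrC divfK// gt_eqF.
have psiE t : psi beta t (beta * w) =
    beta / 2 * (Num.max 0 (t + w) ^+ 2 - w ^+ 2).
  rewrite /psi -mulrDr pmulr_rge0//; case: leP => h; first by field.
  by field; rewrite gt_eqF.
have maxM : Num.max 0 (beta * (a + w)) = beta * Num.max 0 (a + w).
  by rewrite maxr_pMr ?ltW// mulr0.
rewrite !psiE -mulrDr maxM.
rewrite [X in `|X|](_ : _ = beta / 2 * (Num.max 0 (c + w) ^+ 2
  - Num.max 0 (a + w) ^+ 2 - 2 * Num.max 0 (a + w) * (c - a))); last by field.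
have b2 : 0 <= beta / 2 by rewrite divr_ge0 ?ltW.
rewrite normrM (ger0_norm b2) ler_wpM2l// ler_norml.
have -> : c - a = (c + w) - (a + w) by ring.
move: (c + w) (a + w) => e r; have er := sqr_ge0 (e - r).
case: (leP 0 e) => e0; case: (leP 0 r) => r0; rewrite ?expr0n/=.
- by apply/andP; split; nra.
- have : 0 <= e * - r by rewrite mulr_ge0// oppr_ge0 ltW.
  by have := sqr_ge0 e; have := sqr_ge0 r; move=> *; apply/andP; split; nra.
- have : 0 <= r * - e by rewrite mulr_ge0// oppr_ge0 ltW.
  by have := sqr_ge0 e; have := sqr_ge0 r; move=> *; apply/andP; split; nra.
- by apply/andP; split; nra.
Qed.

Lemma is_derive_psi_comp (R : realType) (n : nat) (f : 'cV[R]_n -> R)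
    (beta v : R) x d :
  0 < beta -> differentiable f x ->
  is_derive x d (fun u => psi beta (f u) v)
    (Num.max 0 (beta * f x + v) * dotv (grad f x) d).
Proof.
move=> b0 df; apply/is_derive_cvg.
set zeta := Num.max 0 _; set D := dotv _ _.
pose q (h : R) := h^-1 * (f (h *: d + x) - f x).
have qD : q h @[h --> 0^'] --> D by exact/is_derive_cvg/is_derive_grad.
have h0 : (h : R) @[h --> 0^'] --> (0 : R) by exact: nbhs_dnbhs.
(* [th] is the remainder bound of [psi_taylor] divided by [|h|], written with the difference
   quotient [q] so that it visibly tends to 0. *)
pose th (h : R) := beta / 2 * (`|h| * q h ^+ 2).
have th0 : th h @[h --> 0^'] --> 0.
  rewrite [X in _ --> X](_ : _ = beta / 2 * (`|0 : R| * D ^+ 2));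
    last by rewrite normr0 mul0r mulr0.
  exact: (cvgM (cvg_cst _) (cvgM (cvg_norm h0) (cvgM qD qD))).
have H1 : zeta * q h - th h @[h --> 0^'] --> zeta * D.
  rewrite -[X in _ --> X]subr0; apply: cvgB th0; exact: (cvgM (cvg_cst _) qD).
have H2 : zeta * q h + th h @[h --> 0^'] --> zeta * D.
  rewrite -[X in _ --> X]addr0; apply: cvgD th0; exact: (cvgM (cvg_cst _) qD).
apply: squeeze_cvgr H1 H2; near=> h.
have hn0 : h != 0 by near: h; exact: nbhs_dnbhs_neq.
have -> : zeta * q h = h^-1 * (zeta * (f (h *: d + x) - f x)) by rewrite mulrCA.
rewrite -ler_distlC -mulrBr normrM.
have -> : th h = `|h^-1| * (beta / 2 * (f (h *: d + x) - f x) ^+ 2).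
  rewrite /th /q exprMn -[h^-1 ^+ 2]real_normK ?num_real// normfV.
  by field; rewrite normr_eq0.
by rewrite ler_wpM2l// distrC psi_taylor.
Unshelve. all: by end_near. Qed.

Lemma is_derive_penalty (R : realType) (p q : nat) (A : 'M[R]_(q, p))
    (b y : 'cV[R]_q) (beta : R) (x d : 'cV[R]_p) :
  is_derive x d
    (fun u => dotv y (A *m u - b) + beta / 2 * enorm (A *m u - b) ^+ 2)
    (dotv (A^T *m (y + beta *: (A *m x - b))) d).
Proof.
apply/is_derive_cvg; rewrite dotv_adjoint.
set Ad := A *m d; set r := A *m x - b.
set D := dotv _ Ad.
(* The function is quadratic along the line, so its difference quotient is exactly this affine
   function of [h]. *)
have H : D + h * (beta / 2 * dotv Ad Ad) @[h --> 0^'] --> D.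
  rewrite -[X in _ --> X]addr0 -[X in _ --> D + X](mul0r (beta / 2 * dotv Ad Ad)).
  apply: cvgD; first exact: cvg_cst.
  apply: cvgM; [exact: nbhs_dnbhs|exact: cvg_cst].
apply: cvg_trans H; apply: near_eq_cvg; near=> h.
have hn0 : h != 0 by near: h; exact: nbhs_dnbhs_neq.
have -> : A *m (h *: d + x) - b = h *: Ad + r.
  by rewrite mulmxDr -scalemxAr addrA.
rewrite /D !enorm_sqr dotv_sqrD (dotvDr y (h *: Ad) r) (dotvZr h y Ad).
by rewrite (dotvDl y (beta *: r) Ad) (dotvZl beta r Ad); field.
Unshelve. all: by end_near. Qed.

Lemma grad_auglag (R : realType) (p q m : nat) (P : problem R p q m)
    (beta : R) (x : 'cV[R]_p) (y : 'cV[R]_q) (z : 'cV[R]_m) :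
  0 < beta -> differentiable (smooth_obj P) x ->
  (forall j, differentiable (ineq P j) x) ->
  grad (fun v => auglag P beta v y z) x =
  grad (smooth_obj P) x
  + (Defs.eq_mx P)^T *m (y + beta *: (Defs.eq_mx P *m x - eq_rhs P))
  + \sum_(j < m) Num.max 0 (beta * ineq P j x + z j 0) *: grad (ineq P j) x.
Proof.
move=> b0 dg df; apply: gradP => d.
have -> : (fun v => auglag P beta v y z) = smooth_obj P
    + (fun u => dotv y (Defs.eq_mx P *m u - eq_rhs P)
                + beta / 2 * enorm (Defs.eq_mx P *m u - eq_rhs P) ^+ 2)
    + \sum_(j < m) (fun u => psi beta (ineq P j u) (z j 0)).
  apply/funext => u; rewrite /auglag /Psi !fctE fct_sumE /= addrA //.
rewrite !dotvDl dotv_suml.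
under [X in is_derive _ _ _ (_ + X)]eq_bigr do rewrite dotvZl.
apply: is_deriveD; last first.
  by apply: is_derive_sum => j; exact: is_derive_psi_comp.
by apply: is_deriveD; [exact: is_derive_grad|exact: is_derive_penalty].
Qed.

(** * Extended-valued convex functions and the proximal step *)

Lemma ler_of_small_slope (R : realType) (a b c : R) :
  (forall t, 0 < t <= 1 -> a <= b + t * c) -> a <= b.
Proof.
move=> H; rewrite leNgt; apply/negP => ba.
have [c0|c0] := leP c 0.
  by have := H 1; rewrite ltr01 lexx => /(_ isT); lra.
(* This [t] makes [t * c] at most half of the gap [a - b]. *)
pose t := Num.min 1 ((a - b) / (2 * c)).
have t0 : 0 < t by rewrite lt_min ltr01 divr_gt0 ?mulr_gt0// subr_gt0.
have /H : 0 < t <= 1 by rewrite t0 ge_min lexx.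
have : t * c <= (a - b) / (2 * c) * c by rewrite ler_pM2r// ge_min lexx orbT.
have -> : (a - b) / (2 * c) * c = (a - b) / 2 by field; rewrite gt_eqF.
lra.
Qed.

Section extended_convex.
Variables (R : realType) (n : nat) (h : 'cV[R]_n -> \bar R).
Hypotheses (h_proper : eproper h) (h_convex : econvex h).

Lemma edom_fineK x : edom h x -> (fine (h x))%:E = h x.
Proof.
by move=> xD; apply: fineK; rewrite fin_numElt; apply/andP; split;
  [case: h_proper|].
Qed.

Lemma fine_convex x y t : edom h x -> edom h y -> 0 <= t <= 1 ->
  edom h (t *: (y - x) + x) /\
  fine (h (t *: (y - x) + x)) <= fine (h x) + t * (fine (h y) - fine (h x)).
Proof.
move=> xD yD t01; have := h_convex y x t01.
have -> : t *: y + (1 - t) *: x = t *: (y - x) + x.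
  by rewrite scalerBr scalerBl scale1r addrA addrAC.
rewrite -(edom_fineK xD) -(edom_fineK yD) -!EFinM -EFinD => H.
have D : edom h (t *: (y - x) + x) by apply: le_lt_trans H (ltry _).
split => //; move: H; rewrite -(edom_fineK D) lee_fin => H.
by apply: le_trans H _; rewrite le_eqVlt; apply/orP; left; apply/eqP; ring.
Qed.

(** The minimum is finite because [h] is proper. Comparing [xn] with [xn + t (u - xn)], dividing by
    [t] and letting [t] tend to 0 removes the quadratic term and leaves the first-order
    condition. *)
Lemma prox_optimality (c xk xn : 'cV[R]_n) (e : R) :
  argmin (fun u => h u + (dotv c u + e / 2 * enorm (u - xk) ^+ 2)%:E)%E xn ->
  edom h xn /\
  forall u, edom h u ->
    fine (h xn) <= fine (h u) + dotv (c + e *: (xn - xk)) (u - xn).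
Proof.
move=> H.
have xnD : edom h xn.
  case: h_proper => _ [u uD]; have := H u; rewrite -(edom_fineK uD) -EFinD.
  move=> {}H; have := le_lt_trans H (ltry _).
  by rewrite /edom /=; case: (h xn) => [r||] //= _; rewrite ?ltry ?ltNyr.
split => // u uD.
apply: (@ler_of_small_slope _ _ _ (e / 2 * dotv (u - xn) (u - xn))).
move=> t /andP[t0 t1].
have [|tD tle] := @fine_convex xn u t xnD uD; first by rewrite ltW.
have := H (t *: (u - xn) + xn).
rewrite -(edom_fineK xnD) -(edom_fineK tD) -!EFinD lee_fin.
rewrite -addrA; move: (u - xn) (xn - xk) tle => d g tle.
rewrite !enorm_sqr !dotvE (dotvC d g) => {}H.
by rewrite -(ler_pM2l t0); nra.
Qed.
End extended_convex.

(** * Limits of column vectors along a filter *)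

Section limits.
Variables (R : realType) (T : Type) (F : set_system T).
Context {FF : ProperFilter F}.

Lemma cvg_col n (u : T -> 'cV[R]_n) (l : 'cV[R]_n) :
  (forall i, u t i 0 @[t --> F] --> l i 0) -> u @ F --> l.
Proof.
move=> H A [P lP PA].
have : \forall t \near F, forall i, P i 0 (u t i 0).
  by apply: filter_forall => i; apply: H; apply: lP.
by apply: filterS => t Pt; apply: PA => i j; rewrite ord1; apply: Pt.
Qed.

Lemma col_cvg n (u : T -> 'cV[R]_n) (l : 'cV[R]_n) i :
  u @ F --> l -> u t i 0 @[t --> F] --> l i 0.
Proof.
move=> ul; apply: (@continuous_cvg _ _ _ F _ u (fun M => M i 0) l) => //.
exact: coord_continuous.
Qed.

Lemma cvg_bigsum (V : normedModType R) (I : Type) (r : seq I)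
    (f : I -> T -> V) (l : I -> V) :
  (forall j, f j @ F --> l j) ->
  (\sum_(j <- r) f j t) @[t --> F] --> \sum_(j <- r) l j.
Proof.
move=> H; have -> : (fun t => \sum_(j <- r) f j t) = \sum_(j <- r) f j.
  by apply/funext => t; rewrite fct_sumE.
apply: (big_ind2 (fun (u : T -> V) l => u @ F --> l)) => //.
  exact: cvg_cst.
by move=> u1 l1 u2 l2 h1 h2; apply: cvgD.
Qed.

Lemma cvg_dotv n (u v : T -> 'cV[R]_n) (a b : 'cV[R]_n) :
  u @ F --> a -> v @ F --> b -> dotv (u t) (v t) @[t --> F] --> dotv a b.
Proof.
move=> ua vb; apply: (@cvg_bigsum R) => i.
by apply: cvgM; apply: col_cvg.
Qed.

Lemma cvg_mulmx p q (A : 'M[R]_(q, p)) (u : T -> 'cV[R]_p) (a : 'cV[R]_p) :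
  u @ F --> a -> A *m u t @[t --> F] --> A *m a.
Proof.
move=> ua; apply: cvg_col => i.
have E v : (A *m v) i 0 = dotv (row i A)^T v.
  by rewrite mxE; apply: eq_bigr => j _; rewrite !mxE.
rewrite E; under eq_fun do rewrite E.
by apply: cvg_dotv => //; exact: cvg_cst.
Qed.

(** Bridge between the library topology on columns and the Euclidean distance used in the
    estimates. *)
Lemma cvg_dotv0P n (u : T -> 'cV[R]_n) (l : 'cV[R]_n) :
  u @ F --> l <-> dotv (u t - l) (u t - l) @[t --> F] --> 0.
Proof.
split=> [ul|H].
  have d0 : u t - l @[t --> F] --> (0 : 'cV[R]_n).
    by rewrite -(subrr l); apply: cvgB => //; exact: cvg_cst.
  by rewrite -[X in _ --> X](dotv0l (0 : 'cV[R]_n)); apply: cvg_dotv.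
apply: cvg_col => i; apply/cvgrPdist_lt => e e0.
have e2 : 0 < e ^+ 2 by rewrite exprn_gt0.
move/cvgrPdist_lt : H => /(_ _ e2); apply: filterS => t.
rewrite sub0r normrN ger0_norm ?dotv_ge0// => H.
have : (u t i 0 - l i 0) ^+ 2 < e ^+ 2.
  by apply: le_lt_trans H; have := dotv_coord (u t - l) i; rewrite !mxE.
by rewrite distrC ltr_norml => {}H; apply/andP; split; nra.
Qed.

Lemma cvg_dotv_le n p (u : T -> 'cV[R]_n) (l : 'cV[R]_n)
    (v : T -> 'cV[R]_p) (b : 'cV[R]_p) (c : R) :
  (forall t, dotv (u t - l) (u t - l) <= c * dotv (v t - b) (v t - b)) ->
  v @ F --> b -> u @ F --> l.
Proof.
move=> le_uv /cvg_dotv0P vb; apply/cvg_dotv0P.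
apply: (@squeeze_cvgr _ _ _ _ (cst 0) (fun t => c * dotv (v t - b) (v t - b))).
- by apply: nearW => t; rewrite dotv_ge0 le_uv.
- exact: cvg_cst.
- by rewrite -[X in _ --> X](mulr0 c); apply: cvgM => //; exact: cvg_cst.
Qed.

Lemma cvg_max0 (a : T -> R) (l : R) :
  a @ F --> l -> Num.max 0 (a t) @[t --> F] --> Num.max 0 l.
Proof.
move=> al; have E (b : R) : Num.max 0 b = (b + `|b|) / 2.
  by rewrite maxr_absE add0r sub0r normrN.
rewrite E; under eq_fun do rewrite E.
by apply: cvgM; [apply: cvgD => //; exact: cvg_norm|exact: cvg_cst].
Qed.

End limits.

(** * Bounded families converge along an ultrafilter *)

Section ultrafilter_limits.
Variables (R : realType) (T : Type) (U : set_system T).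
Hypothesis U_ultra : UltraFilter U.

(** Compactness of [[- M, M]] yields a cluster point. For each of its neighborhoods [B], the
    ultrafilter contains the preimage of [B] or of its complement, and clustering excludes the
    latter. *)
Lemma ultra_bounded_cvg (a : T -> R) (M : R) :
  (\forall t \near U, `|a t| <= M) -> exists l : R, a @ U --> l.
Proof.
move=> aM; have UP : ProperFilter U := @ultra_proper _ _ U_ultra.
have := @segment_compact R (- M) M (a @ U) _.
have aU : (a @ U) `[- M, M]%classic.
  by apply: filterS aM => t; rewrite /= in_itv /= ler_norml.
move=> /(_ _ aU) [l [_ lU]]; exists l => B lB.
have [//|UB] := in_ultra_setVsetC (a @^-1` B) U_ultra.
by have [x []] := lU (~` B) B UB lB.
Qed.

Lemma ultra_bounded_col_cvg n (u : T -> 'cV[R]_n) (c : 'cV[R]_n) (M : R) :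
  (\forall t \near U, dotv (u t - c) (u t - c) <= M) ->
  exists l : 'cV[R]_n, u @ U --> l.
Proof.
move=> uM; have UP : ProperFilter U := @ultra_proper _ _ U_ultra.
have H i : exists l : R, u t i 0 @[t --> U] --> l.
  apply: (@ultra_bounded_cvg _ (`|c i 0| + (1 + M))).
  apply: filterS uM => t utM.
  have := le_trans (dotv_coord (u t - c) i) utM; rewrite !mxE => H.
  rewrite -(subrK (c i 0) (u t i 0)) addrC (le_trans (ler_normD _ _))//.
  (* From [2 w <= 1 + w^2] and [w^2 <= M] follows [w <= 1 + M], a bound free of square roots. *)
  rewrite lerD2l; have := sqr_ge0 (`|u t i 0 - c i 0| - 1).
  have := @real_normK _ (u t i 0 - c i 0) (num_real _).
  by move: `|_| H => w H; have := sqr_ge0 w; nra.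
exists (\col_i xget 0 [set l : R | u t i 0 @[t --> U] --> l]).
by apply: cvg_col => i; rewrite mxE; exact: (xgetPex 0 (H i)).
Qed.

End ultrafilter_limits.

(** * Monotone sequences and a growth bound *)

Lemma nonincreasing_diff_cvg0 (R : realType) (W : nat -> R) :
  (forall k, 0 <= W k) -> (forall k, W k.+1 <= W k) ->
  W k - W k.+1 @[k --> \oo] --> 0.
Proof.
move=> W0 WS.
have cW : cvgn W.
  apply: nonincreasing_is_cvgn; first exact/nonincreasing_seqP.
  by exists 0 => _ [k _ <-].
rewrite -(subrr (limn W)); apply: cvgB => //.
by rewrite cvg_shiftS.
Qed.

(** Monotonicity already gives a limit along [\oo]; since [U] is finer, uniqueness of limits
    identifies it. *)
Lemma nonincreasing_cvg0_ultra (R : realType) (W : nat -> R)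
    (U : set_system nat) :
  ProperFilter U -> \oo `<=` U ->
  (forall k, 0 <= W k) -> (forall k, W k.+1 <= W k) ->
  W @ U --> 0 -> W @ \oo --> 0.
Proof.
move=> UP sU W0 WS WU.
have cW : cvgn W.
  apply: nonincreasing_is_cvgn; first exact/nonincreasing_seqP.
  by exists 0 => _ [k _ <-].
have /cvg_unique : W @ U --> limn W by move=> A /cW /sU.
by move=> /(_ (@Rhausdorff _) _ WU) <-.
Qed.

(* A bound c0 + c1 t on e reproduces itself once t^2 >= W (c0 + c1 t). *)
Lemma growth_bound (R : realType) (e Y : nat -> R) (W c0 c1 : R) :
  0 <= W -> 0 <= c1 ->
  (forall k, Y k.+1 <= e k * W) ->
  (forall k t, 0 <= t -> Y k.+1 <= t ^+ 2 ->
     e k.+1 <= Num.max (e k) (c0 + c1 * t)) ->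
  exists M, forall k, e k <= M.
Proof.
move=> W0 c10 YW eS.
(* The term [|e 0|] starts the induction, and the choice of [t >= 1] gives
   [t^2 = t + W C t + W c1 t >= W (C + c1 t)]. *)
pose C := `|c0| + `|e 0%N|; pose t := 1 + W * (C + c1).
have C0 : 0 <= C by rewrite addr_ge0.
have t1 : 1 <= t by rewrite lerDl mulr_ge0// addr_ge0.
have t0 : 0 <= t by apply: le_trans t1.
have fix_t : (C + c1 * t) * W <= t ^+ 2.
  have h1 : 0 <= W * C * (t - 1) by rewrite !mulr_ge0// subr_ge0.
  have -> : t ^+ 2 = t + W * C * t + W * c1 * t 
    by rewrite /t; ring.
  by lra.
exists (C + c1 * t); elim => [|k IH].
  rewrite -addrA addrC -addrA (le_trans (ler_norm _))//.
  by rewrite lerDl addr_ge0 ?mulr_ge0.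
have := eS k t t0 (le_trans (YW k) (le_trans (ler_wpM2r W0 IH) fix_t)).
move=> /le_trans; apply; rewrite ge_max IH lerD2r /C.
by rewrite (le_trans (ler_norm _))// lerDl.
Qed.

(** * Estimates for a smooth convex function on a convex set *)

Section convex_set_estimates.
Variables (R : realType) (n : nat) (f : 'cV[R]_n -> R) (D : set 'cV[R]_n).
Hypotheses (f_convex : convex_function [set: 'cV[R]_n] f)
  (f_diff : forall x, differentiable f x)
  (D_convex : forall x y t, D x -> D y -> 0 <= t <= 1 -> D (t *: (y - x) + x)).

(** The descent lemma from [x] to [x'] is combined with the gradient inequality from [x] to [u]. *)
Lemma three_point_grad_le L x x' u : lipschitz_grad L D f -> D x -> D x' ->
  f x' - f u - L / 2 * dotv (x' - x) (x' - x) <= dotv (grad f x) (x' - u).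
Proof.
move=> Lf xD xD'.
have := descent_lemma f_diff Lf (fun t => D_convex xD xD').
have := convex_grad_le u f_convex (f_diff x).
rewrite !(dotvDr (grad f x)) !dotvNr; lra.
Qed.

Lemma le_bounded_grad B x x' : (forall x, D x -> enorm (grad f x) <= B) ->
  D x -> f x - f x' <= B * enorm (x - x').
Proof.
move=> Bf xD; have := convex_grad_le x' f_convex (f_diff x).
rewrite -(opprB x x') dotvNr.
have := dotv_le_enorm (grad f x) (x - x').
have := ler_wpM2r (enorm_ge0 (x - x')) (Bf _ xD); lra.
Qed.

Lemma sqr_le_bounded_grad B x x' : (forall x, D x -> enorm (grad f x) <= B) ->
  D x -> D x' -> (f x' - f x) ^+ 2 <= B ^+ 2 * dotv (x' - x) (x' - x).
Proof.
move=> Bf xD xD'; rewrite -enorm_sqr -exprMn.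
have := le_bounded_grad x Bf xD'; have := le_bounded_grad x' Bf xD.
rewrite -(opprB x' x) enormN => h1 h2.
set c := B * _ in h1 h2 *; nra.
Qed.

(** No sign is assumed on the Lipschitz constants; two distinct points of [D] force it. *)
Lemma lipschitz_grad_ge0 L a b : lipschitz_grad L D f -> D a -> D b ->
  a != b -> 0 <= L.
Proof.
move=> Lf aD bD ab.
have ab0 : 0 < enorm (a - b).
  rewrite lt_neqAle enorm_ge0 andbT eq_sym; apply/eqP => /enorm_eq0/eqP.
  by rewrite subr_eq0 (negbTE ab).
by rewrite -(pmulr_lge0 _ ab0) (le_trans (enorm_ge0 _) (Lf _ _ aD bD)).
Qed.

End convex_set_estimates.

(** * The iterates: optimality, multipliers and step parameters *)

Section LALM.
Variables (R : realType) (p q m : nat) (P : problem R p q m).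
Variables (Lg : R) (L B : 'I_m -> R) (beta rho_y rho_z delta : R).
Variables (x : nat -> 'cV[R]_p) (y : nat -> 'cV[R]_q) (z : nat -> 'cV[R]_m).
Hypotheses (P_convex : convex_problem P) (P_lip : lipschitz_bounded P Lg L B).
Hypotheses (beta_gt0 : 0 < beta) (rho_y_itv : 0 < rho_y < beta)
  (rho_z_itv : 0 < rho_z < beta) (delta_gt0 : 0 < delta).
Hypothesis z0_ge0 : forall j, 0 <= z 0%N j 0.
Hypothesis xyz_LALM : is_LALM P Lg L B beta rho_y rho_z delta x y z.

Local Notation A := (Defs.eq_mx P).
Local Notation b := (eq_rhs P).
Local Notation g := (smooth_obj P).
Local Notation h := (nonsmooth_obj P).
Local Notation f := (ineq P).
Local Notation D := (edom (nonsmooth_obj P)).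
Local Notation eta_ k := (eta P Lg L B beta delta x z k).
Local Notation LF_ k := (LF P Lg L B beta (x k) (z k)).

Definition residual k := A *m x k - b.

Definition mult_step k : 'cV[R]_m :=
  \col_j Num.max (- (z k j 0 / beta)) (f j (x k.+1)).

Let g_convex : convex_function [set: 'cV[R]_p] g.
Proof. by case: P_convex => -[]. Qed.
Let g_diff u : differentiable g u.
Proof. by case: P_convex => -[]. Qed.
Let f_convex j : convex_function [set: 'cV[R]_p] (f j).
Proof. by case: P_convex => _ /(_ j) []. Qed.
Let f_diff j u : differentiable (f j) u.
Proof. by case: P_convex => _ /(_ j) []. Qed.
Let h_proper : eproper h. Proof. by case: P_convex. Qed.
Let h_convex : econvex h. Proof. by case: P_convex. Qed.
Let g_lip : lipschitz_grad Lg D g. Proof. by case: P_lip. Qed.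
Let f_lip j : lipschitz_grad (L j) D (f j).
Proof. by case: P_lip => _ /(_ j) []. Qed.
Let f_bnd j u : D u -> enorm (grad (f j) u) <= B j.
Proof. by case: P_lip => _ /(_ j) [_]; exact. Qed.
Let D_convex u v t : D u -> D v -> 0 <= t <= 1 -> D (t *: (v - u) + u).
Proof. by move=> uD vD t01; case: (fine_convex h_proper h_convex uD vD t01). Qed.

Let rho_y_gt0 : 0 < rho_y. Proof. by case/andP: rho_y_itv. Qed.
Let rho_z_gt0 : 0 < rho_z. Proof. by case/andP: rho_z_itv. Qed.

(** The gradient of the augmented Lagrangian in the closed form of [grad_auglag]: that of the smooth
    part of the ordinary Lagrangian at shifted multipliers. *)
Definition lagr_grad k : 'cV[R]_p :=
  grad g (x k) + A^T *m (y k + beta *: residual k)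
  + \sum_(j < m) Num.max 0 (beta * f j (x k) + z k j 0) *: grad (f j) (x k).

Lemma LALM_prox k :
  D (x k.+1) /\ forall u, D u ->
    fine (h (x k.+1)) <= fine (h u)
      + dotv (lagr_grad k + eta_ k *: (x k.+1 - x k)) (u - x k.+1).
Proof.
case: (xyz_LALM k) => H _ _.
have := prox_optimality h_proper h_convex H.
by rewrite grad_auglag.
Qed.

Lemma LALM_edom k : D (x k.+1). Proof. by case: (LALM_prox k). Qed.

Lemma LALM_y k : y k.+1 = y k + rho_y *: residual k.+1.
Proof. by case: (xyz_LALM k). Qed.

Lemma LALM_z k : z k.+1 = z k + rho_z *: mult_step k.
Proof.
by apply/matrixP => j i; rewrite ord1 !mxE; case: (xyz_LALM k) => _ _ ->.
Qed.

(** The step is at least [- z / beta], so the update keeps at least the fraction [1 - rho_z / beta]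
    of the old multiplier. *)
Lemma LALM_z_ge0 k j : 0 <= z k j 0.
Proof.
elim: k => [|k IH]; first exact: z0_ge0.
rewrite LALM_z !mxE; set s := Num.max _ _.
have s_ge : - (z k j 0 / beta) <= s by rewrite le_max lexx.
have : rho_z * - (z k j 0 / beta) <= rho_z * s by rewrite ler_pM2l.
have : rho_z * (z k j 0 / beta) <= z k j 0.
  rewrite mulrCA ler_piMr// ler_pdivrMr// mul1r.
  by case/andP: rho_z_itv => _ /ltW.
lra.
Qed.

Lemma LF_le_eta k : LF_ k + delta <= eta_ k.
Proof. by case: k => [|k] /=; rewrite le_max lexx orbT. Qed.

Lemma LF_ge0 a u k : D a -> D u -> a != u -> 0 <= LF_ k.
Proof.
move=> aD uD au; rewrite /LF; apply: addr_ge0; first apply: addr_ge0.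
- exact: (lipschitz_grad_ge0 g_lip aD uD au).
- by rewrite mulr_ge0 ?sqr_ge0 ?ltW.
apply: sumr_ge0 => j _; apply: addr_ge0.
  by rewrite mulr_ge0 ?sqr_ge0 ?(ltW beta_gt0).
rewrite mulr_ge0 ?le_max ?lexx//.
exact: (lipschitz_grad_ge0 (@f_lip j) aD uD au).
Qed.

(* Replaces eta, which can be 0 when dom h is a singleton and the Lipschitz
   constants are negative. *)
Definition scale k := Num.max delta (eta_ k).

Lemma scale_gt0 k : 0 < scale k.
Proof. by rewrite lt_max delta_gt0. Qed.

Lemma scale_ge_delta k : delta <= scale k.
Proof. by rewrite le_max lexx. Qed.

Lemma scaleS k : scale k.+1 = Num.max (scale k) (LF_ k.+1 + delta).
Proof. by rewrite /scale /= maxA. Qed.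

Lemma scale_homo k : scale k <= scale k.+1.
Proof. by rewrite scaleS le_max lexx. Qed.

Lemma eta_ge0 k : 0 <= eta_ k.
Proof. by elim: k => [|k IH] /=; rewrite le_max ?lexx ?IH. Qed.

(** Two points in the domain make [LF] nonnegative, hence [eta] at least [delta]. *)
Lemma scale_eta a u k : D a -> D u -> a != u -> scale k = eta_ k.
Proof.
move=> aD uD au; apply/max_idPr.
by rewrite (le_trans _ (LF_le_eta k))// lerDr (LF_ge0 k aD uD au).
Qed.

(** * The Fejer-type inequality at a KKT point *)

Section Fejer.
Variables (xs : 'cV[R]_p) (ys : 'cV[R]_q) (zs : 'cV[R]_m).
Hypothesis KKT : is_KKT P xs ys zs.

Definition primal_dist k := dotv (x k - xs) (x k - xs).

Definition dual_dist k := dotv (y k - ys) (y k - ys) / rho_y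
                          + dotv (z k - zs) (z k - zs) / rho_z.

Definition decrease k := delta * dotv (x k.+1 - x k) (x k.+1 - x k)
  + (beta - rho_y) * dotv (residual k.+1) (residual k.+1)
  + (beta - rho_z) * dotv (mult_step k) (mult_step k).

Lemma KKT_edom : D xs.
Proof.
case: KKT => -[s sub _] _ _.
case: h_proper => _ [u uD]; have := sub u; rewrite -(edom_fineK h_proper uD).
move=> H; have {H} := le_lt_trans H (ltry _).
by rewrite /edom /=; case: (h xs) => [r||] //= _; rewrite ?ltry ?ltNyr.
Qed.

(** The Lagrangian at the multipliers [ys], [zs] is minimal at [xs]: add the subgradient and
    gradient inequalities, the latter weighted by [zs], and cancel the linear terms by stationarity.
    Complementarity removes the constraint values at [xs]. *)
Lemma KKT_lagrangian u : D u ->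
  0 <= fine (h u) + g u - fine (h xs) - g xs + dotv ys (A *m u - b)
       + \sum_(j < m) zs j 0 * f j u.
Proof.
move=> uD; case: KKT => -[s sub sE] Axs zf.
have := sub u; rewrite -(edom_fineK h_proper uD) -(edom_fineK h_proper KKT_edom).
rewrite -EFinD lee_fin => hs.
have gs := convex_grad_le u g_convex (g_diff xs).
have : \sum_(j < m) zs j 0 * dotv (grad (f j) xs) (u - xs)
       <= \sum_(j < m) zs j 0 * f j u.
  apply: ler_sum => j _; case: (zf j) => z0 _ zf0.
  have := ler_wpM2l z0 (convex_grad_le u (@f_convex j) (f_diff j xs)).
  by rewrite mulrBr zf0 subr0.
have := congr1 (fun w => dotv w (u - xs)) sE.
rewrite dotv0l !dotvDl dotv_suml dotv_adjoint mulmxBr Axs.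
have -> : \sum_i dotv (zs i 0 *: grad (f i) xs) (u - xs)
  = \sum_(j < m) zs j 0 * dotv (grad (f j) xs) (u - xs).
  by apply: eq_bigr => j _; rewrite dotvZl.
lra.
Qed.

(** [three_point_grad_le] is multiplied by the weight, [f j xs <= 0] is used, and
    [multiplier_descent] is applied; its error [(fn - f)^2] is at most [B j ^+ 2] times the squared
    step. The error coefficient is half the [j]-th term of [LF]. *)
Lemma constraint_estimate k j : D (x k) ->
  (z k j 0 - zs j 0) * mult_step k j 0 + beta / 2 * mult_step k j 0 ^+ 2
  + zs j 0 * f j (x k.+1)
  - (beta * B j ^+ 2 + L j * Num.max 0 (beta * f j (x k) + z k j 0)) / 2
    * dotv (x k.+1 - x k) (x k.+1 - x k)
  <= Num.max 0 (beta * f j (x k) + z k j 0)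
     * dotv (grad (f j) (x k)) (x k.+1 - xs).
Proof.
move=> xD; case: KKT => _ _ /(_ j) [zs0 fs0 _].
have xD' := LALM_edom k.
set N := dotv (x k.+1 - x k) _; set ze := Num.max 0 _.
have ze0 : 0 <= ze by rewrite le_max lexx.
have h1 := ler_wpM2l ze0
  (three_point_grad_le (@f_convex j) (f_diff j) D_convex xs (@f_lip j) xD xD').
have h2 := sqr_le_bounded_grad (@f_convex j) (f_diff j) (@f_bnd j) xD xD'.
have h3 := multiplier_descent (f j (x k)) (f j (x k.+1)) beta_gt0
  (LALM_z_ge0 k j) zs0.
have h4 : 0 <= ze * - f j xs by rewrite mulr_ge0// oppr_ge0.
have h5 := ler_wpM2l (ltW beta_gt0) h2.
move: h1 h3 h5; rewrite -/N -/ze /= /mult_step mxE.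
move: (dotv (grad _ _) _) (Num.max (- _) _) => c s; nra.
Qed.

(** The right side pairs [y + beta r] with the new residual [r']. Polarization writes [2 r.r'] as
    [|r|^2 + |r'|^2 - |r' - r|^2], and [r' - r] is the image under [A] of the step. *)
Lemma equality_estimate k :
  dotv (y k) (residual k.+1)
  + beta / 2 * dotv (residual k.+1) (residual k.+1)
  - beta * spectral_norm A ^+ 2 / 2 * dotv (x k.+1 - x k) (x k.+1 - x k)
  <= dotv (A^T *m (y k + beta *: residual k)) (x k.+1 - xs).
Proof.
case: KKT => _ Axs _; rewrite dotv_adjoint mulmxBr Axs -/(residual k.+1).
set N := dotv (x k.+1 - x k) _.
have : dotv (residual k.+1 - residual k) (residual k.+1 - residual k)
       <= spectral_norm A ^+ 2 * N.
  have -> : residual k.+1 - residual k = A *m (x k.+1 - x k).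
    by rewrite /residual mulmxBr opprB addrA subrK.
  rewrite /N -!enorm_sqr -exprMn ler_sqr ?nnegrE ?enorm_ge0//.
    exact: mulmx_le_spectral.
  exact: le_trans (enorm_ge0 _) (mulmx_le_spectral _ _).
move: (residual k.+1) (residual k) => r' r.
rewrite !dotvE (dotvC r r') => H.
have := mulr_ge0 (ltW beta_gt0) (dotv_ge0 r).
have := ler_wpM2l (ltW beta_gt0) H; move: (dotv r r) (dotv r' r') => c d; lra.
Qed.

(** The proximal inequality is tested at [xs], its gradient term is bounded below by the estimates
    for [g], the equalities and the inequalities, and [KKT_lagrangian] removes the function values.
    The errors sum to [LF / 2] times the squared step, and [LF + delta <= eta] leaves the [delta]
    term. *)
Lemma eta_descent k : D (x k) ->
  eta_ k * (primal_dist k.+1 - primal_dist k)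
  + (dual_dist k.+1 - dual_dist k) + decrease k <= 0.
Proof.
move=> xD; have xD' := LALM_edom k.
set N := dotv (x k.+1 - x k) (x k.+1 - x k).
have h1 := (LALM_prox k).2 _ KKT_edom.
have h2 := KKT_lagrangian xD'.
have h3 := three_point_grad_le g_convex g_diff D_convex xs g_lip xD xD'.
have h4 := equality_estimate k.
have h5 : dotv (z k - zs) (mult_step k)
    + beta / 2 * dotv (mult_step k) (mult_step k)
    + \sum_(j < m) zs j 0 * f j (x k.+1)
    - (\sum_(j < m) (beta * B j ^+ 2
         + L j * Num.max 0 (beta * f j (x k) + z k j 0))) / 2 * N
    <= \sum_(j < m) Num.max 0 (beta * f j (x k) + z k j 0)
        * dotv (grad (f j) (x k)) (x k.+1 - xs).
  rewrite /dotv mulr_sumr !mulr_suml -!big_split /= -sumrB.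
  apply: ler_sum => j _; apply: le_trans (constraint_estimate j xD).
  by rewrite !mxE -/N expr2.
have h6 := LF_le_eta k; rewrite /LF in h6.
have N0 : 0 <= N by exact: dotv_ge0.
have h7 := ler_wpM2r N0 h6.
(* Three-point identity for the proximal term; [hy] and [hz] expand the multiplier updates in the
   same way. *)
have hx : dotv (eta_ k *: (x k.+1 - x k)) (xs - x k.+1)
  = - (eta_ k / 2 * (primal_dist k.+1 - primal_dist k + N)).
  have E : x k - xs = - (x k.+1 - x k) + (x k.+1 - xs).
    by rewrite opprB addrA subrK.
  rewrite /primal_dist E -(opprB (x k.+1) xs) /N.
  move: (x k.+1 - xs) (x k.+1 - x k) => a d.
  by rewrite !dotvE (dotvC a d); field.
have hy : (dotv (y k.+1 - ys) (y k.+1 - ys) - dotv (y k - ys) (y k - ys)) / rho_y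
  = 2 * (dotv (y k) (residual k.+1) - dotv ys (residual k.+1))
    + rho_y * dotv (residual k.+1) (residual k.+1).
  have <- : dotv (y k - ys) (residual k.+1)
    = dotv (y k) (residual k.+1) - dotv ys (residual k.+1).
    by rewrite dotvDl dotvNl.
  rewrite LALM_y [y k + _ - ys]addrAC.
  move: (y k - ys) (residual k.+1) => a r.
  by rewrite !dotvE (dotvC r a); field; rewrite gt_eqF.
have hz : (dotv (z k.+1 - zs) (z k.+1 - zs) - dotv (z k - zs) (z k - zs)) / rho_z
  = 2 * dotv (z k - zs) (mult_step k)
    + rho_z * dotv (mult_step k) (mult_step k).
  rewrite LALM_z [z k + _ - zs]addrAC.
  move: (z k - zs) (mult_step k) => a r.
  by rewrite !dotvE (dotvC r a); field; rewrite gt_eqF.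
have -> : dual_dist k.+1 - dual_dist k =
    (dotv (y k.+1 - ys) (y k.+1 - ys) - dotv (y k - ys) (y k - ys)) / rho_y
  + (dotv (z k.+1 - zs) (z k.+1 - zs) - dotv (z k - zs) (z k - zs)) / rho_z.
  by rewrite /dual_dist !mulrBl; ring.
have hc : dotv (lagr_grad k) (x k.+1 - xs)
  = dotv (grad g (x k)) (x k.+1 - xs)
  + dotv (A^T *m (y k + beta *: residual k)) (x k.+1 - xs)
  + \sum_(j < m) Num.max 0 (beta * f j (x k) + z k j 0)
        * dotv (grad (f j) (x k)) (x k.+1 - xs).
  rewrite /lagr_grad !dotvDl dotv_suml; congr (_ + _).
  by apply: eq_bigr => j _; rewrite dotvZl.
move: h1; rewrite dotvDl hx -(opprB (x k.+1) xs) dotvNr hc => h1.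
rewrite hy hz /decrease -/N.
move: h2; rewrite -/(residual k.+1) => h2.
move: h1 h2 h3 h4 h5 h7; rewrite -/N.
move: (\sum_(j < m) _) (\sum_(j < m) _) (\sum_(j < m) _) => S1 S2 S3.
lra.
Qed.

(** If [x k] or [x k.+1] differs from [xs], then [scale k = eta_ k]; otherwise both primal distances
    vanish and the coefficient is immaterial. *)
Lemma scale_descent k : D (x k) ->
  scale k * (primal_dist k.+1 - primal_dist k)
  + (dual_dist k.+1 - dual_dist k) + decrease k <= 0.
Proof.
move=> xD; have := eta_descent xD; have xD' := LALM_edom k.
have [xxs|xxs] := eqVneq (x k) xs; last first.
  by rewrite (scale_eta k xD KKT_edom xxs).
have [xxs'|xxs'] := eqVneq (x k.+1) xs; last first.
  by rewrite (scale_eta k xD' KKT_edom xxs').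
by rewrite /primal_dist xxs xxs' !subrr !mulr0.
Qed.

(** * A nonincreasing energy *)

Lemma dual_dist_ge0 k : 0 <= dual_dist k.
Proof. by rewrite addr_ge0// divr_ge0 ?dotv_ge0// ltW. Qed.

(** The index is shifted by one because the descent inequality starts at [x 1], the first iterate
    known to lie in [D]. *)
Definition energy k := primal_dist k.+1 + dual_dist k.+1 / scale k.+1.

Lemma energy_ge0 k : 0 <= energy k.
Proof.
by rewrite addr_ge0 ?dotv_ge0// divr_ge0 ?dual_dist_ge0// ltW ?scale_gt0.
Qed.

Lemma decrease_terms_ge0 k :
  [/\ 0 <= delta * dotv (x k.+1 - x k) (x k.+1 - x k),
      0 <= (beta - rho_y) * dotv (residual k.+1) (residual k.+1) &
      0 <= (beta - rho_z) * dotv (mult_step k) (mult_step k)].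
Proof.
have [_ by0] := andP rho_y_itv; have [_ bz0] := andP rho_z_itv.
by split; rewrite mulr_ge0 ?dotv_ge0 ?subr_ge0 ?ltW.
Qed.

Lemma decrease_ge0 k : 0 <= decrease k.
Proof. by have [? ? ?] := decrease_terms_ge0 k; rewrite !addr_ge0. Qed.

(** Divide [scale_descent] by [scale k.+1]; replacing this divisor by the larger [scale k.+2] under
    the new dual distance only lowers the energy. *)
Lemma energy_descent k : energy k.+1 + decrease k.+1 / scale k.+1 <= energy k.
Proof.
have := scale_descent (LALM_edom k); have e0 := scale_gt0 k.+1.
rewrite /energy; set X := primal_dist k.+1; set X' := primal_dist k.+2 => H.
have h1 : dual_dist k.+2 / scale k.+2 <= dual_dist k.+2 / scale k.+1.
  by rewrite ler_wpM2l ?dual_dist_ge0// lef_pV2 ?posrE ?scale_gt0// scale_homo.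
suff : X' - X + (dual_dist k.+2 - dual_dist k.+1 + decrease k.+1) / scale k.+1
       <= 0.
  move: (dual_dist k.+2) (dual_dist k.+1) (decrease k.+1) h1 => d2 d1 w h1.
  by rewrite !mulrDl mulNr; lra.
by rewrite -(pmulr_rle0 _ e0) mulrDr mulrCA divff ?gt_eqF// mulr1 addrA.
Qed.

Lemma energyS k : energy k.+1 <= energy k.
Proof.
apply: le_trans (energy_descent k); rewrite lerDl.
by rewrite divr_ge0 ?decrease_ge0// ltW ?scale_gt0.
Qed.

Lemma energy_le0 k : energy k <= energy 0.
Proof. by elim: k => // k; apply: le_trans; exact: energyS. Qed.

(** * Boundedness of the scale and vanishing increments *)

Lemma primal_dist_le k : primal_dist k.+1 <= energy 0.
Proof.
apply: le_trans (energy_le0 k); rewrite lerDl.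
by rewrite divr_ge0 ?dual_dist_ge0// ltW ?scale_gt0.
Qed.

Lemma dual_dist_le k : dual_dist k.+1 <= scale k.+1 * energy k.
Proof.
rewrite mulrDr mulrCA divff ?gt_eqF ?scale_gt0// mulr1 lerDr.
by rewrite mulr_ge0 ?dotv_ge0// ltW ?scale_gt0.
Qed.

(** This is the linear growth required by [growth_bound]: [f j] is bounded above through
    [f j xs <= 0] and the primal distance, while the multiplier grows linearly in [t]. Absolute
    values appear because [L] and [B] carry no sign. *)
Lemma weight_bound k j t : 0 <= t -> dual_dist k.+1 <= t ^+ 2 ->
  L j * Num.max 0 (beta * f j (x k.+1) + z k.+1 j 0)
  <= `|L j| * (beta * (`|B j| * (1 + energy 0)) + `|zs j 0|)
     + `|L j| * (1 + rho_z) * t.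
Proof.
move=> t0 Yt; have W0 := energy_ge0 0.
have [_ fs0 _] : [/\ 0 <= zs j 0, f j xs <= 0 & zs j 0 * f j xs = 0].
  by case: KKT.
have dx : enorm (x k.+1 - xs) <= 1 + energy 0.
  have := primal_dist_le k; rewrite /primal_dist -enorm_sqr.
  by move: (enorm _) (enorm_ge0 (x k.+1 - xs)) => c; nra.
have fx : f j (x k.+1) <= `|B j| * (1 + energy 0).
  have := le_bounded_grad (@f_convex j) (f_diff j) xs (@f_bnd j) (LALM_edom k).
  have := ler_wpM2r (enorm_ge0 (x k.+1 - xs)) (ler_norm (B j)).
  have := ler_wpM2l (normr_ge0 (B j)) dx; lra.
(* The factor [1 + rho_z] stands for the square root of [rho_z], as [rho_z <= (1 + rho_z)^2]. *)
have dz : z k.+1 j 0 - zs j 0 <= (1 + rho_z) * t.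
  have h1 : dotv (z k.+1 - zs) (z k.+1 - zs) <= rho_z * t ^+ 2.
    rewrite -ler_pdivrMl// mulrC (le_trans _ Yt)// lerDr.
    by rewrite divr_ge0 ?dotv_ge0// ltW.
  have := le_trans (dotv_coord _ j) h1; rewrite !mxE.
  move: (z k.+1 j 0 - zs j 0) => c {}h1; rewrite leNgt; apply/negP => h2.
  have h3 : 0 <= (1 + rho_z) * t by rewrite mulr_ge0// addr_ge0// ltW.
  have : ((1 + rho_z) * t) ^+ 2 < c ^+ 2.
    by rewrite ltr_sqr ?nnegrE// ltW// (le_lt_trans h3).
  have := mulr_ge0 (ltW rho_z_gt0) (sqr_ge0 t).
  have := mulr_ge0 (ltW rho_z_gt0) (mulr_ge0 (ltW rho_z_gt0) (sqr_ge0 t)).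
  have := sqr_ge0 t; nra.
have w0 : 0 <= Num.max 0 (beta * f j (x k.+1) + z k.+1 j 0).
  by rewrite le_max lexx.
apply: le_trans (ler_wpM2r w0 (ler_norm (L j))) _.
rewrite -mulrA -mulrDr ler_wpM2l// ge_max; apply/andP; split.
  have hr : 0 <= (1 + rho_z) * t by rewrite mulr_ge0// addr_ge0// ltW.
  by rewrite addr_ge0// addr_ge0// mulr_ge0 ?(ltW beta_gt0)// mulr_ge0// addr_ge0.
have := ler_wpM2l (ltW beta_gt0) fx; have := ler_norm (zs j 0); lra.
Qed.

Lemma scale_bounded : exists M, forall k, scale k.+1 <= M.
Proof.
pose c0 := Lg + beta * spectral_norm A ^+ 2 + delta + \sum_(j < m)
  (beta * B j ^+ 2
   + `|L j| * (beta * (`|B j| * (1 + energy 0)) + `|zs j 0|)).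
pose c1 := \sum_(j < m) `|L j| * (1 + rho_z).
apply: (@growth_bound _ _ (fun k => dual_dist k.+1) (energy 0) c0 c1).
- exact: energy_ge0.
- by apply: sumr_ge0 => j _; rewrite mulr_ge0// addr_ge0// ltW.
(* The dual distance at [k.+2] must be controlled by the scale one index earlier, so [scale_descent]
   is used in place of [dual_dist_le]. *)
- move=> k; rewrite -(ler_pM2r (_ : 0 < (scale k.+1)^-1)) ?invr_gt0 ?scale_gt0//.
  rewrite [leRHS]mulrAC divff ?gt_eqF ?scale_gt0// mul1r.
  apply: le_trans (energy_le0 k); have H := scale_descent (LALM_edom k).
  have e0 := scale_gt0 k.+1.
  rewrite /energy -(ler_pM2l e0) mulrCA divff ?gt_eqF// mulr1 mulrDr.
  rewrite mulrCA divff ?gt_eqF// mulr1.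
  have := decrease_ge0 k.+1.
  have : 0 <= scale k.+1 * primal_dist k.+2 by rewrite mulr_ge0 ?dotv_ge0// ltW.
  lra.
move=> k t t0 Yt; rewrite scaleS ge_max le_max lexx /= le_max; apply/orP; right.
rewrite /LF /c0 /c1 mulr_suml -[leRHS]addrA -big_split /=.
rewrite [leLHS]addrAC lerD2l; apply: ler_sum => j _.
by rewrite -[leRHS]addrA lerD2l; exact: weight_bound.
Qed.

(** A bounded scale gives [decrease k.+1 <= M (energy k - energy k.+1)], and these differences
    vanish. *)
Lemma decrease_cvg0 : decrease k.+1 @[k --> \oo] --> 0.
Proof.
have [M scaleM] := scale_bounded.
apply: (@squeeze_cvgr _ _ _ _ (cst 0) (fun k => M * (energy k - energy k.+1))).
- apply: nearW => k; rewrite decrease_ge0 /=.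
  have e0 := scale_gt0 k.+1.
  have : decrease k.+1 / scale k.+1 <= energy k - energy k.+1.
    by have := energy_descent k; lra.
  rewrite ler_pdivrMr// mulrC => /le_trans; apply.
  by rewrite ler_wpM2r// subr_ge0 energyS.
- exact: cvg_cst.
rewrite -[X in _ --> X](mulr0 M); apply: cvgM; first exact: cvg_cst.
exact: nonincreasing_diff_cvg0 energy_ge0 energyS.
Qed.

Lemma step_cvg0 : dotv (x k.+2 - x k.+1) (x k.+2 - x k.+1) @[k --> \oo] --> 0.
Proof.
apply: (@squeeze_cvgr _ _ _ _ (cst 0) (fun k => delta^-1 * decrease k.+1)).
- apply: nearW => k; rewrite dotv_ge0 /= ler_pdivlMl//.
  by have [? ? ?] := decrease_terms_ge0 k.+1; rewrite /decrease; lra.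
- exact: cvg_cst.
rewrite -[X in _ --> X](mulr0 delta^-1); apply: cvgM; first exact: cvg_cst.
exact: decrease_cvg0.
Qed.

Lemma mult_step_cvg0 :
  dotv (mult_step k.+1) (mult_step k.+1) @[k --> \oo] --> 0.
Proof.
have bz0 : 0 < beta - rho_z by rewrite subr_gt0; case/andP: rho_z_itv.
apply: (@squeeze_cvgr _ _ _ _ (cst 0)
  (fun k => (beta - rho_z)^-1 * decrease k.+1)).
- apply: nearW => k; rewrite dotv_ge0 /= ler_pdivlMl//.
  by have [? ? ?] := decrease_terms_ge0 k.+1; rewrite /decrease; lra.
- exact: cvg_cst.
rewrite -[X in _ --> X](mulr0 (beta - rho_z)^-1).
by apply: cvgM; [exact: cvg_cst|exact: decrease_cvg0].
Qed.

Lemma residual_cvg0 :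
  dotv (residual k.+2) (residual k.+2) @[k --> \oo] --> 0.
Proof.
have by0 : 0 < beta - rho_y by rewrite subr_gt0; case/andP: rho_y_itv.
apply: (@squeeze_cvgr _ _ _ _ (cst 0)
  (fun k => (beta - rho_y)^-1 * decrease k.+1)).
- apply: nearW => k; rewrite dotv_ge0 /= ler_pdivlMl//.
  by have [? ? ?] := decrease_terms_ge0 k.+1; rewrite /decrease; lra.
- exact: cvg_cst.
rewrite -[X in _ --> X](mulr0 (beta - rho_y)^-1).
by apply: cvgM; [exact: cvg_cst|exact: decrease_cvg0].
Qed.

End Fejer.
Lemma h_closed : eclosed h. Proof. by case: P_convex. Qed.

(** * Limits along an ultrafilter are KKT points *)

Section limit_point.
Variables (xs : 'cV[R]_p) (ys : 'cV[R]_q) (zs : 'cV[R]_m).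
Hypothesis KKT : is_KKT P xs ys zs.
Variables (U : set_system nat) (xb : 'cV[R]_p) (yb : 'cV[R]_q) (zb : 'cV[R]_m).
Hypotheses (U_ultra : UltraFilter U) (sub_U : \oo `<=` U).
Hypotheses (x_cvg : x k.+1 @[k --> U] --> xb)
  (y_cvg : y k.+1 @[k --> U] --> yb) (z_cvg : z k.+1 @[k --> U] --> zb).

Let U_proper : ProperFilter U := @ultra_proper _ _ U_ultra.

Let U_dotv0 n (u : nat -> 'cV[R]_n) :
  dotv (u k) (u k) @[k --> \oo] --> 0 -> u @ U --> (0 : 'cV[R]_n).
Proof.
move=> u0; apply/cvg_dotv0P; under eq_fun do rewrite subr0.
by move=> S /u0 /sub_U.
Qed.

Lemma dx_cvg : x k.+2 - x k.+1 @[k --> U] --> (0 : 'cV[R]_p).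
Proof. exact/U_dotv0/(step_cvg0 KKT). Qed.

(** An ultrafilter is not invariant under index shifts; the vanishing step carries the limit over to
    the next iterate. *)
Lemma x2_cvg : x k.+2 @[k --> U] --> xb.
Proof.
have -> : (fun k => x k.+2) = (fun k => (x k.+2 - x k.+1) + x k.+1).
  by apply/funext => k; rewrite subrK.
rewrite -[xb]add0r; exact: (cvgD dx_cvg x_cvg).
Qed.

Lemma limit_feasible : A *m xb = b.
Proof.
have r0 : residual k.+2 @[k --> U] --> (0 : 'cV[R]_q).
  exact/U_dotv0/(residual_cvg0 KKT).
have rb : residual k.+2 @[k --> U] --> A *m xb - b.
  rewrite /residual; apply: cvgB; last exact: cvg_cst.
  exact: cvg_mulmx x2_cvg.
by apply/eqP; rewrite -subr_eq0; apply/eqP;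
  exact: (cvg_unique (@norm_hausdorff R 'cV[R]_q) rb r0).
Qed.

Lemma f_cvg (u : nat -> 'cV[R]_p) l j :
  u @ U --> l -> f j (u k) @[k --> U] --> f j l.
Proof.
by move=> ul; apply: continuous_cvg => //; exact/differentiable_continuous.
Qed.

Lemma limit_complementary j : [/\ 0 <= zb j 0, f j xb <= 0 & zb j 0 * f j xb = 0].
Proof.
have s0 : mult_step k.+1 j 0 @[k --> U] --> (0 : R).
  have <- : (0 : 'cV[R]_m) j 0 = 0 by rewrite mxE.
  exact: col_cvg (U_dotv0 (mult_step_cvg0 KKT)).
have zj : z k.+1 j 0 @[k --> U] --> zb j 0 by exact: col_cvg z_cvg.
have fj : f j (x k.+2) @[k --> U] --> f j xb by exact: f_cvg x2_cvg.
have zb0 : 0 <= zb j 0.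
  by apply: (cvgr_to_ge zj); apply: nearW => k; exact: LALM_z_ge0.
have fb0 : f j xb <= 0.
  by apply: (ler_cvg_to fj s0); apply: nearW => k; rewrite mxE le_max lexx orbT.
split => //.
(* The step is the larger of [f j (x k.+2)] and [- z / beta], so one factor is always zero; in the
   limit this product becomes complementarity. *)
have H : (mult_step k.+1 j 0 - f j (x k.+2))
    * (mult_step k.+1 j 0 + z k.+1 j 0 / beta)
    @[k --> U] --> (0 - f j xb) * (0 + zb j 0 / beta).
  apply: cvgM; first exact: cvgB.
  by apply: cvgD => //; apply: cvgM => //; exact: cvg_cst.
have H0 : (mult_step k.+1 j 0 - f j (x k.+2))
    * (mult_step k.+1 j 0 + z k.+1 j 0 / beta)
    @[k --> U] --> (0 : R).
  rewrite [X in X @ _](_ : _ = cst 0); first exact: cvg_cst.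
  apply/funext => k; rewrite mxE.
  by case: leP => _; rewrite ?subrr ?mul0r// addNr mulr0.
have : (0 - f j xb) * (0 + zb j 0 / beta) = 0.
  exact: (cvg_unique (@norm_hausdorff R R) H H0).
rewrite sub0r add0r => /eqP; rewrite mulNr oppr_eq0 mulf_eq0 mulf_eq0 invr_eq0.
rewrite (gt_eqF beta_gt0) orbF => /orP[] /eqP ->; by rewrite ?mulr0 ?mul0r.
Qed.

Definition limit_grad : 'cV[R]_p :=
  grad g xb + A^T *m yb + \sum_(j < m) zb j 0 *: grad (f j) xb.

(** The global Lipschitz constant from [smooth_convex] is used, since [xb] is not yet known to lie
    in [D]. *)
Lemma grad_cvg (k0 : 'cV[R]_p -> R) : smooth_convex k0 ->
  grad k0 (x k.+1) @[k --> U] --> grad k0 xb.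
Proof.
case=> _ _ [l Hl]; apply: (cvg_dotv_le (c := l ^+ 2) _ x_cvg) => k.
rewrite -!enorm_sqr -exprMn ler_sqr ?nnegrE ?enorm_ge0//; first exact: Hl.
exact: le_trans (enorm_ge0 _) (Hl (x k.+1) xb I I).
Qed.

Lemma lagr_grad_cvg : lagr_grad k.+1 @[k --> U] --> limit_grad.
Proof.
rewrite /lagr_grad /limit_grad; apply: cvgD; first apply: cvgD.
- by apply: grad_cvg; case: P_convex.
- apply: cvg_mulmx; rewrite -[yb]addr0 -(scaler0 _ beta) -(subrr b).
  rewrite -[X in X - b]limit_feasible.
  apply: cvgD => //; apply: cvgZ; first exact: cvg_cst.
  by apply: cvgB; [exact: cvg_mulmx|exact: cvg_cst].
apply: (@cvg_bigsum _ _ _ _ 'cV[R]_p) => j; apply: cvgZ; last first.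
  by apply: grad_cvg; case: P_convex.
have [z0 f0 zf0] := limit_complementary j.
(* By complementarity the shifted multiplier has the same limit as the multiplier itself. *)
have -> : zb j 0 = Num.max 0 (beta * f j xb + zb j 0).
  move/eqP: zf0; rewrite mulf_eq0 => /orP[] /eqP E.
    by rewrite E addr0; apply/esym/max_idPl; rewrite pmulr_rle0.
  by rewrite E mulr0 add0r; apply/esym/max_idPr.
apply: cvg_max0; apply: cvgD; last exact: col_cvg.
by apply: cvgM; [exact: cvg_cst|exact: f_cvg].
Qed.

(** The pairs [(x k.+2, t k)] lie in the closed epigraph of [h], and so does their limit; the
    proximal term vanishes because [eta] is bounded. The inequality is between extended reals, as it
    also serves to prove [h xb] finite. *)
Lemma limit_prox u : D u ->
  (h xb <= (fine (h u) + dotv limit_grad (u - xb))%:E)%E.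
Proof.
move=> uD.
have [M scaleM] := scale_bounded KKT.
have [eb eta_cvg] : exists e : R, eta_ k.+1 @[k --> U] --> e.
  apply: (@ultra_bounded_cvg _ _ _ U_ultra _ M); apply: nearW => k.
  rewrite ger0_norm ?eta_ge0// (le_trans _ (scaleM k))//.
  by rewrite le_max lexx orbT.
pose t k := fine (h u)
  + dotv (lagr_grad k.+1 + eta_ k.+1 *: (x k.+2 - x k.+1)) (u - x k.+2).
have t_cvg : t @ U --> fine (h u) + dotv limit_grad (u - xb).
  rewrite /t; apply: cvgD; first exact: cvg_cst.
  apply: cvg_dotv; last by apply: cvgB; [exact: cvg_cst|exact: x2_cvg].
  rewrite -[limit_grad]addr0 -(scaler0 _ eb); apply: cvgD.
    exact: lagr_grad_cvg.
  exact: cvgZ eta_cvg dx_cvg.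
have xt_cvg : (x k.+2, t k) @[k --> U] -->
    (xb, fine (h u) + dotv limit_grad (u - xb)).
  exact: (cvg_pair x2_cvg t_cvg).
apply: (closed_cvg _ h_closed _ _ xt_cvg); apply: nearW => k /=.
have [xD prox] := LALM_prox k.+1.
by rewrite -(edom_fineK h_proper xD) lee_fin; exact: prox.
Qed.

Lemma limit_KKT : is_KKT P xb yb zb.
Proof.
split; last exact: limit_complementary; last exact: limit_feasible.
(* Stationarity forces this subgradient; [limit_prox] is its inequality on [D]. *)
exists (- limit_grad); last first.
  by rewrite /limit_grad; rewrite -!addrA [- _ + _]addrC !addrA subrr.
have [_ [u0 u0D]] := h_proper.
have xbD : D xb by apply: le_lt_trans (limit_prox u0D) (ltry _).
move=> u /=; have [uD|uD] := pselect (D u); last first.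
  by move/negP: uD; rewrite /edom /= -leNgt leye_eq => /eqP ->; rewrite leey.
have := limit_prox uD.
rewrite -(edom_fineK h_proper xbD) -(edom_fineK h_proper uD) -EFinD !lee_fin.
by rewrite dotvNl; lra.
Qed.

End limit_point.

(** * Convergence of the whole sequence *)

Lemma LALM_cvg : (exists x' y' z', is_KKT P x' y' z') ->
  exists xbar ybar zbar, is_KKT P xbar ybar zbar /\
    (fun k => (x k, y k, z k)) @ \oo --> (xbar, ybar, zbar).
Proof.
move=> [xs [ys [zs KKT]]].
(* An ultrafilter finer than [\oo] plays the role of a convergent subsequence. *)
have [U [U_ultra sub_U]] := ultraFilterLemma (@eventually_filter).
have U_proper : ProperFilter U := @ultra_proper _ _ U_ultra.
have [M scaleM] := scale_bounded KKT.
have dual_bnd k : dual_dist ys zs k.+1 <= M * energy xs ys zs 0.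
  apply: le_trans (dual_dist_le xs ys zs k) _.
  apply: ler_pM; [exact/ltW/scale_gt0|exact: energy_ge0|exact: scaleM|].
  exact: energy_le0 KKT _.
have y_le k y' z' : dotv (y k - y') (y k - y') <= rho_y * dual_dist y' z' k.
  rewrite -ler_pdivrMl// mulrC lerDl.
  by rewrite divr_ge0 ?dotv_ge0// ltW.
have z_le k y' z' : dotv (z k - z') (z k - z') <= rho_z * dual_dist y' z' k.
  rewrite -ler_pdivrMl// mulrC lerDr.
  by rewrite divr_ge0 ?dotv_ge0// ltW.
have [xb x_cvg] : exists l : 'cV[R]_p, x k.+1 @[k --> U] --> l.
  apply: (@ultra_bounded_col_cvg _ _ _ U_ultra _ _ xs (energy xs ys zs 0)).
  by apply: nearW => k; exact: primal_dist_le.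
have [yb y_cvg] : exists l : 'cV[R]_q, y k.+1 @[k --> U] --> l.
  apply: (@ultra_bounded_col_cvg _ _ _ U_ultra _ _ ys
    (rho_y * (M * energy xs ys zs 0))).
  apply: nearW => k.
  exact: le_trans (y_le _ _ zs) (ler_wpM2l (ltW rho_y_gt0) (dual_bnd _)).
have [zb z_cvg] : exists l : 'cV[R]_m, z k.+1 @[k --> U] --> l.
  apply: (@ultra_bounded_col_cvg _ _ _ U_ultra _ _ zs
    (rho_z * (M * energy xs ys zs 0))).
  apply: nearW => k.
  exact: le_trans (z_le _ ys _) (ler_wpM2l (ltW rho_z_gt0) (dual_bnd _)).
have KKTb := limit_KKT KKT U_ultra sub_U x_cvg y_cvg z_cvg.
exists xb, yb, zb; split=> //.
have [Mb scaleMb] := scale_bounded KKTb.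
(* The energy is now centered at the limit point. As [scale] is at least [delta], it is dominated by
   distances that vanish along [U]. *)
have energyU : energy xb yb zb k @[k --> U] --> 0.
  have dualU : dual_dist yb zb k.+1 @[k --> U] --> 0 / rho_y + 0 / rho_z.
    by apply: cvgD; apply: cvgM; [|exact: cvg_cst| |exact: cvg_cst];
      exact/cvg_dotv0P.
  have boundU : primal_dist xb k.+1 + dual_dist yb zb k.+1 / delta @[k --> U]
      --> 0 + (0 / rho_y + 0 / rho_z) / delta.
    by apply: cvgD; [exact/cvg_dotv0P|apply: cvgM => //; exact: cvg_cst].
  apply: (@squeeze_cvgr _ _ _ _ (cst 0)
    (fun k => primal_dist xb k.+1 + dual_dist yb zb k.+1 / delta)).
  - apply: nearW => k; rewrite energy_ge0 lerD2l ler_wpM2l ?dual_dist_ge0//.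
    by rewrite lef_pV2 ?posrE ?scale_gt0 ?scale_ge_delta.
  - exact: cvg_cst.
  rewrite [X in _ --> X](_ : _ = 0 + (0 / rho_y + 0 / rho_z) / delta) //.
  by rewrite !mul0r addr0 mul0r addr0.
have energy0 := nonincreasing_cvg0_ultra U_proper sub_U
  (energy_ge0 xb yb zb) (energyS KKTb) energyU.
have sq0 n (u : nat -> 'cV[R]_n) (l : 'cV[R]_n) c :
    (forall k, dotv (u k.+1 - l) (u k.+1 - l) <= c * energy xb yb zb k) ->
    u @ \oo --> l.
  move=> ule; rewrite -(cvg_shiftS u); apply/cvg_dotv0P.
  apply: (@squeeze_cvgr _ _ _ _ (cst 0) (fun k => c * energy xb yb zb k)).
  - by apply: nearW => k; rewrite dotv_ge0 ule.
  - exact: cvg_cst.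
  by rewrite -[X in _ --> X](mulr0 c); apply: cvgM => //; exact: cvg_cst.
(* The upper bound on the scale turns decay of the energy into decay of the dual distance. *)
have dual_le k : dual_dist yb zb k.+1 <= Mb * energy xb yb zb k.
  apply: le_trans (dual_dist_le xb yb zb k) _.
  by rewrite ler_wpM2r ?energy_ge0.
have x_lim : x @ \oo --> xb.
  apply: (sq0 _ _ _ 1) => k; rewrite mul1r lerDl.
  by rewrite divr_ge0 ?dual_dist_ge0// ltW ?scale_gt0.
have y_lim : y @ \oo --> yb.
  apply: (sq0 _ _ _ (rho_y * Mb)) => k; rewrite -mulrA.
  exact: le_trans (y_le _ _ zb) (ler_wpM2l (ltW rho_y_gt0) (dual_le _)).
have z_lim : z @ \oo --> zb.
  apply: (sq0 _ _ _ (rho_z * Mb)) => k; rewrite -mulrA.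
  exact: le_trans (z_le _ yb _) (ler_wpM2l (ltW rho_z_gt0) (dual_le _)).
exact: (cvg_pair (cvg_pair x_lim y_lim) z_lim).
Qed.

End LALM.

Theorem theorem3p2 (R : realType) (p q m : nat) (P : problem R p q m)
    (Lg : R) (L B : 'I_m -> R) (beta rho_y rho_z delta : R)
    (x : nat -> 'cV[R]_p) (y : nat -> 'cV[R]_q) (z : nat -> 'cV[R]_m)
    (P_convex : convex_problem P)
    (P_KKT : exists x' y' z', is_KKT P x' y' z')
    (P_lip : lipschitz_bounded P Lg L B)
    (beta_gt0 : 0 < beta)
    (rho_y_itv : 0 < rho_y < beta)
    (rho_z_itv : 0 < rho_z < beta)
    (delta_gt0 : 0 < delta)
    (z0_ge0 : forall j, 0 <= z 0%N j 0)
    (xyz_LALM : is_LALM P Lg L B beta rho_y rho_z delta x y z) :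
  exists xbar ybar zbar,
    is_KKT P xbar ybar zbar /\
    (fun k => (x k, y k, z k)) @ \oo --> (xbar, ybar, zbar).
Proof.
exact: (LALM_cvg P_convex P_lip beta_gt0 rho_y_itv rho_z_itv delta_gt0 z0_ge0
  xyz_LALM P_KKT).
Qed.
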